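(* For every $n\ge 1$ there is a bijection between the set $\mathcal{GD}_n$ of Grand-Dyck paths of length $2n$ and the set $B_n(312,\overline{312},2\overline{1},\overline{2}1)$ of signed permutations of size $n$ avoiding the four signed patterns $312$, $\overline{312}$, $2\overline{1}$ and $\overline{2}1$.
   Context: A Grand-Dyck path of length $2n$ is a lattice path from $(0,0)$ to $(2n,0)$ using steps $U=(1,1)$ and $D=(1,-1)$. $B_n$ is the set of all signed permutations $\pi=\pi_1\cdots\pi_n$, i.e. permutations of $\{1,\ldots,n\}$ in which each entry may carry a sign, denoted by an overline; $|x|$ denotes an entry without its sign. $\pi$ contains a signed pattern $\sigma=\sigma_1\cdots\sigma_m$ if there are positions $i_1<\cdots<i_m$ such that $|\pi_{i_1}|,\ldots,|\pi_{i_m}|$ are in the same relative order as $|\sigma_1|,\ldots,|\sigma_m|$ and $\pi_{i_j}$ is signed if and only if $\sigma_j$ is signed; otherwise it avoids $\sigma$. The pattern $\overline{312}$ has all three entries signed. *)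

(* Defs.v *)
From mathcomp Require Import all_boot all_order all_algebra.

Set Implicit Arguments.
Unset Strict Implicit.
Unset Printing Implicit Defensive.

Import Order.TTheory GRing.Theory Num.Theory.
Local Open Scope ring_scope.

(* A lattice path starting at (0,0) is encoded by its sequence of step vectors;
   its end point is then the sum of the steps. *)
Definition U : int * int := (1, 1).
Definition D : int * int := (1, -1).

Definition is_grand_dyck (n : nat) (p : seq (int * int)) : bool :=
  all [in [:: U; D]] p && (\sum_(v <- p) v == ((2 * n)%N%:Z, 0)).

Definition grand_dyck (n : nat) := {p : seq (int * int) | is_grand_dyck n p}.

(* Signed permutations are given in one-line notation; an overlined entry is a
   negative integer. The entries of a signed permutation are nonzero. *)
Definition is_signed_perm (n : nat) (w : seq int) : bool :=
  perm_eq [seq `|x|%N | x <- w] (iota 1 n).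

Definition contains (s w : seq int) : bool :=
  [exists i : {ffun 'I_(size s) -> 'I_(size w)},
    [&& [forall a : 'I_(size s), forall b : 'I_(size s),
           (a < b)%N ==> (i a < i b)%N],
        [forall a : 'I_(size s), forall b : 'I_(size s),
           (`|w`_(i a)| < `|w`_(i b)|) == (`|s`_a| < `|s`_b|)] &
        [forall a : 'I_(size s), (w`_(i a) < 0) == (s`_a < 0)]]].

Definition signed_perm_avoiding (n : nat) (S : seq (seq int)) :=
  {w : seq int | is_signed_perm n w && all (fun s => ~~ contains s w) S}.

(* Main.v *)
From HB Require Import structures.
Require Import Defs.
From mathcomp Require Import all_boot all_order all_algebra.
From mathcomp Require Import zify.

(** Both sides have the same recursive structure, recorded here by binary trees
    whose nodes carry a sign.

    A nonempty Grand-Dyck path factors uniquely at its first return to the axis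
    as [s A s' B]: [s] is its first step, [s'] the opposite step, [A] stays on
    the side of the axis chosen by [s], and [B] is any Grand-Dyck path.

    On the other side, an inversion of the absolute values between entries of
    different signs is one of the patterns [2 -1] and [-2 1]; when these are
    avoided, an occurrence of 312 in the absolute values has constant sign, so
    it is one of the two signed patterns of length three. Hence the avoiders are
    the words whose absolute values avoid 312 and whose inversions have constant
    sign. Cut such a word at its entry [z] of smallest absolute value, [A z B].
    Avoiding 312 forces every entry of [A] to be smaller than every entry of
    [B], and every entry of [A] forms an inversion with [z], hence has the sign
    of [z]. Conversely [A] may be any avoider of that constant sign and [B] any
    avoider at all.

    So both families are in bijection with the trees in which the left subtree
    of every node on the right spine has the sign of that node throughout
    ([coherent]): see [path_bij] and [word_bij]. *)

Set Implicit Arguments.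
Unset Strict Implicit.
Unset Printing Implicit Defensive.

Import Order.TTheory GRing.Theory Num.Theory.
Local Open Scope ring_scope.

(** * Signed binary trees *)

Inductive tree := Leaf | Node of bool & tree & tree.

(** Trees need a choice structure so that encodings of trees can be inverted. *)
Fixpoint code_tree (t : tree) : GenTree.tree bool :=
  if t is Node s a b then
    GenTree.Node 0 [:: GenTree.Leaf s; code_tree a; code_tree b]
  else GenTree.Node 1 [::].

Fixpoint decode_tree (c : GenTree.tree bool) : option tree :=
  match c with
  | GenTree.Node 0 [:: GenTree.Leaf s; a; b] =>
    if decode_tree a is Some a' then omap (Node s a') (decode_tree b) else None
  | GenTree.Node 1 [::] => Some Leaf
  | _ => None
  end.

Lemma code_treeK : pcancel code_tree decode_tree.
Proof. by elim=> //= s a -> b ->. Qed.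

HB.instance Definition _ := Choice.copy tree (pcan_type code_treeK).

Fixpoint nodes (t : tree) : nat :=
  if t is Node _ a b then (nodes a + nodes b).+1 else 0%N.

Fixpoint constant (s : bool) (t : tree) : bool :=
  if t is Node s' a b then [&& s' == s, constant s a & constant s b] else true.

Fixpoint coherent (t : tree) : bool :=
  if t is Node s a b then constant s a && coherent b else true.

Lemma constant_coherent s t : constant s t -> coherent t.
Proof. by elim: t => //= s' a _ b IHb /and3P[/eqP-> -> /IHb]. Qed.

(** Choice on the source of a bijective encoding provides its inverse. *)
Lemma sig_bijection (T : choiceType) (X : eqType) (P : pred T) (Q : pred X)
    (e : T -> X) :
    (forall t, P t -> Q (e t)) -> {in P &, injective e} ->
    (forall x, Q x -> exists2 t, P t & e t = x) ->
  exists f : {t | P t} -> {x | Q x}, bijective f.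
Proof.
move=> PQ e_inj e_surj.
have surj (y : {x | Q x}) : exists t, P t && (e t == val y).
  by case: (e_surj _ (valP y)) => t Pt et; exists t; rewrite Pt et eqxx.
have Pch y : P (xchoose (surj y)) by case/andP: (xchooseP (surj y)).
have ech y : e (xchoose (surj y)) = val y.
  by case/andP: (xchooseP (surj y)) => _ /eqP.
exists (fun t => exist _ (e (val t)) (PQ _ (valP t))).
exists (fun y => exist _ (xchoose (surj y)) (Pch y)) => [t|y]; apply: val_inj.
  by apply: e_inj; [exact: Pch | exact: valP | exact: ech].
exact: ech.
Qed.

(** * Trees and Grand-Dyck paths *)

Definition step (s : bool) : int * int := if s then D else U.

Lemma step_inj : injective step. Proof. by do 2!case. Qed.

Fixpoint path_of (t : tree) : seq bool :=
  if t is Node s a b then s :: path_of a ++ ~~ s :: path_of b else [::].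

Lemma count_path t s : count_mem s (path_of t) = nodes t.
Proof.
elim: t => //= s' a IHa b IHb.
by rewrite count_cat /= IHa IHb; case: (s); case: s' => /=; lia.
Qed.

(** A path of constant sign [s] never leaves the side of [s], so the step [~~ s]
    that follows it is recognizable as the first one out of that side: this is
    the unique reading of balanced parentheses. *)
Lemma constant_path_inj s a a' x x' :
    constant s a -> constant s a' ->
    path_of a ++ ~~ s :: x = path_of a' ++ ~~ s :: x' ->
  a = a' /\ x = x'.
Proof.
elim: a a' x x' => [|t a IHa b IHb] [|t' a' b'] x x' //=.
- by move=> _ _ [].
- by move=> _ /and3P[/eqP-> _ _] []; case: (s).
- by move=> /and3P[/eqP-> _ _] _ []; case: (s).
case/and3P=> /eqP-> ca cb /and3P[/eqP-> ca' cb'] [].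
rewrite -!catA !cat_cons => /(IHa _ _ _ ca ca')[<-].
by case/(IHb _ _ _ cb cb')=> <- <-.
Qed.

Lemma path_of_inj : {in coherent &, injective path_of}.
Proof.
move=> t t'; rewrite /in_mem /=.
elim: t t' => [|s a _ b IHb] [|s' a' b'] //=.
case/andP=> ca cb /andP[ca' cb'] [ess'].
rewrite -{}ess' in ca' *.
by move=> /(constant_path_inj ca ca')[<-] /(IHb _ cb cb')<-.
Qed.

(** A path that ends strictly on the side opposite to [s] has a first step out of
    the side of [s]. When [p] itself starts with [s], its tail exits twice: the
    first exit closes this step, the second one is the exit of [p]. *)
Lemma first_exit s p :
    (count_mem s p < count_mem (~~ s) p)%N ->
  exists a x, constant s a /\ p = path_of a ++ ~~ s :: x.
Proof.
have [k] := ubnP (size p); elim: k p => // k IHk [|c p] //= le_pk lt_p.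
have [ecs | nsc] := eqVneq c s; last first.
  by exists Leaf, p; case: c s nsc {lt_p IHk} => [] [].
rewrite {}ecs eqxx in lt_p *.
have {}lt_p : ((count_mem s p).+1 < count_mem (~~ s) p)%N.
  by move: lt_p; case: (s) => /=; lia.
case: (IHk p) => // [|a [x [ca epx]]]; first by lia.
case: (IHk x).
- by move: le_pk; rewrite epx size_cat /=; lia.
- by move: lt_p; rewrite epx !count_cat !count_path /=; case: (s) => /=; lia.
move=> b [y [cb exy]]; exists (Node s a b), y; split; first by rewrite /= eqxx ca.
by rewrite epx exy /= -catA.
Qed.

Lemma path_of_surj p :
    count_mem true p = count_mem false p ->
  exists2 t, coherent t & path_of t = p.
Proof.
have [k] := ubnP (size p); elim: k p => // k IHk [|s p] le_pk e_p.
  by exists Leaf.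
case: (@first_exit s p) => [|a [x [ca epx]]].
  by move: e_p; rewrite /=; case: (s) => /=; lia.
case: (IHk x).
- by move: le_pk; rewrite /= epx size_cat /=; lia.
- by move: e_p; rewrite /= epx !count_cat !count_path /=; case: (s) => /=; lia.
by move=> b cb ebx; exists (Node s a b); rewrite /= ?ca ?epx ?ebx.
Qed.

Lemma sum_steps q :
  \sum_(v <- map step q) v =
    ((size q)%:Z, (count_mem false q)%:Z - (count_mem true q)%:Z).
Proof.
elim: q => [|s q IHq]; first by rewrite big_nil.
rewrite big_cons {}IHq; case: s => /=.
  by congr pair => /=; lia.
by congr pair => /=; lia.
Qed.

Lemma size_count_bool (q : seq bool) :
  size q = (count_mem true q + count_mem false q)%N.
Proof. by elim: q => //= -[] q ->; rewrite /=; lia. Qed.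

Lemma is_grand_dyckE n q :
  is_grand_dyck n (map step q) =
    (count_mem true q == n) && (count_mem false q == n).
Proof.
rewrite /is_grand_dyck sum_steps all_map.
have -> : all (preim step [in [:: U; D]]) q by apply/allP=> -[].
rewrite xpair_eqE size_count_bool /=; lia.
Qed.

(** The common parameter set of both families. *)
Definition tree_pred (n : nat) : pred tree :=
  fun t => coherent t && (nodes t == n).

Lemma path_bij n :
  exists f : {t | tree_pred n t} -> grand_dyck n, bijective f.
Proof.
apply: (@sig_bijection _ _ _ _ (map step \o path_of)) => [t|t t'|p].
- by case/andP=> _ /eqP<-; rewrite is_grand_dyckE !count_path !eqxx.
- rewrite /in_mem /= => /andP[ct _] /andP[ct' _] /(inj_map step_inj).
  exact: path_of_inj.
move=> gp; have [q epq] : exists q, p = map step q.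
  exists (map (fun v => v == D) p); rewrite -map_comp map_id_in //.
  case/andP: gp => /allP UDp _ v /UDp /=; rewrite !inE.
  by case/orP=> /eqP->.
move: gp; rewrite epq is_grand_dyckE => /andP[/eqP ct /eqP cf].
case: (@path_of_surj q) => [|t ct' etq]; first by rewrite ct.
exists t; last by rewrite /= etq.
by rewrite /tree_pred ct' -(count_path t true) etq ct eqxx.
Qed.

(** * Pattern containment through subsequences *)

Definition matches (s v : seq int) : Prop :=
  [/\ size v = size s,
      forall a b, (a < size s)%N -> (b < size s)%N ->
        (`|v`_a| < `|v`_b|) = (`|s`_a| < `|s`_b|) &
      forall a, (a < size s)%N -> (v`_a < 0) = (s`_a < 0)].

(** Recovers the positions of a subsequence, as the definition of containment
    speaks of positions. *)
Lemma subseq_indices (w v : seq int) :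
  subseq v w ->
  exists2 I, subseq I (iota 0 (size w)) & v = map (nth 0 w) I.
Proof.
case/subseqP=> m em ->; exists (mask m (iota 0 (size w))).
  exact: mask_subseq.
by rewrite map_mask; congr mask; rewrite -{1}(mkseq_nth 0 w).
Qed.

Lemma indices_subseq (w : seq int) I :
  sorted ltn I -> all (gtn (size w)) I -> subseq (map (nth 0 w) I) w.
Proof.
(* A strictly increasing list of indices is a filtering of all of them. *)
move=> sI /allP ltI; have -> : I = filter [in I] (iota 0 (size w)).
  apply: (irr_sorted_eq ltn_trans ltnn) => //.
    by apply: sorted_filter (iota_ltn_sorted _ _); apply: ltn_trans.
  move=> i; rewrite mem_filter mem_iota add0n /=.
  by case Ii: (i \in I) => //=; have /= -> := ltI i Ii.
by rewrite -{3}(mkseq_nth 0 w); apply/map_subseq/filter_subseq.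
Qed.

Lemma containsP s w :
  reflect (exists2 v : seq int, subseq v w & matches s v) (contains s w).
Proof.
apply: (iffP existsP) => [[i /and3P[inc ord sgn]] | [v /subseq_indices[I sI ->]]].
  pose I := [seq val (i a) | a <- enum 'I_(size s)].
  have nthI (a : 'I_(size s)) : nth 0%N I a = i a.
    by rewrite (nth_map a) ?size_enum_ord // nth_ord_enum.
  have szI : size I = size s by rewrite size_map size_enum_ord.
  exists (map (nth 0 w) I); last first.
    split=> [|a b lta ltb|a lta]; first by rewrite size_map.
      rewrite !(nth_map 0%N) ?szI // (nthI (Ordinal lta)) (nthI (Ordinal ltb)).
      by move/forallP/(_ (Ordinal lta))/forallP/(_ (Ordinal ltb))/eqP: ord.
    rewrite !(nth_map 0%N) ?szI // (nthI (Ordinal lta)).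
    by move/forallP/(_ (Ordinal lta))/eqP: sgn.
  apply: indices_subseq; last first.
    by apply/allP=> _ /mapP[a _ ->] /=.
  apply/(sortedP 0%N) => k; rewrite szI => ltk.
  have ltk' := ltnW ltk.
  rewrite (nthI (Ordinal ltk)) (nthI (Ordinal ltk')).
  move/forallP/(_ (Ordinal ltk'))/forallP/(_ (Ordinal ltk))/implyP: inc.
  by apply.
case; rewrite size_map => szI ord sgn.
have ltI (a : 'I_(size s)) : (nth 0%N I a < size w)%N.
  have /(mem_subseq sI) : nth 0%N I a \in I by rewrite mem_nth ?szI.
  by rewrite mem_iota.
exists [ffun a => Ordinal (ltI a)]; apply/and3P; split.
- apply/forallP=> a; apply/forallP=> b; apply/implyP=> ltab; rewrite !ffunE /=.
  have /(sorted_ltn_nth ltn_trans 0%N) : sorted ltn I.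
    by apply: (subseq_sorted ltn_trans sI); apply: iota_ltn_sorted.
  by apply; rewrite ?inE ?szI.
- apply/forallP=> a; apply/forallP=> b; rewrite !ffunE /= -ord //.
  by rewrite !(nth_map 0%N) ?szI.
apply/forallP=> a; rewrite !ffunE /= -sgn //.
by rewrite !(nth_map 0%N) ?szI.
Qed.

Section Subseq23.
Variable T : eqType.
Implicit Types (w : seq T).

Lemma pairwise_subseqP (r : rel T) w :
  reflect (forall x y, subseq [:: x; y] w -> r x y) (pairwise r w).
Proof.
elim: w => [|z w IHw]; first by constructor.
rewrite pairwise_cons; apply: (iffP andP) => [[rz /IHw rw] x y | H].
  rewrite /=; case: eqVneq => [-> | _]; last exact: rw.
  by rewrite sub1seq => /(allP rz).
split; first by apply/allP=> y wy; apply: H; rewrite /= eqxx sub1seq.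
apply/IHw=> x y sxy; apply: H; apply: subseq_trans sxy _; exact: subseq_cons.
Qed.

Fixpoint triplewise (r : T -> rel T) w : bool :=
  if w is x :: w' then pairwise (r x) w' && triplewise r w' else true.

Lemma triplewise_subseqP (r : T -> rel T) w :
  reflect (forall x y z, subseq [:: x; y; z] w -> r x y z) (triplewise r w).
Proof.
elim: w => [|u w IHw]; first by constructor.
apply: (iffP andP) => [[/pairwise_subseqP ru /IHw rw] x y z | H].
  by rewrite /=; case: eqVneq => [-> | _]; [apply: ru | apply: rw].
split; first by apply/pairwise_subseqP=> y z s; apply: H; rewrite /= eqxx.
apply/IHw=> x y z s; apply: H; apply: subseq_trans s _; exact: subseq_cons.
Qed.

End Subseq23.

Definition same_sign_inv : rel int :=
  fun x y => (`|x| < `|y|) || ((x < 0) == (y < 0)).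

Definition not312 (c a b : int) : bool := ~~ ((`|a| < `|b|) && (`|b| < `|c|)).

Definition good (w : seq int) : bool :=
  pairwise same_sign_inv w && triplewise not312 w.

(** Since absolute values are distinct, an inversion with two signs is [2 -1] or
    [-2 1]. Once these are excluded, the first entry of a 312 in absolute value
    shares its sign with the two others, so the triple matches [3 1 2] or
    [-3 -1 -2]. *)
Lemma avoids_good (w : seq int) : uniq (map absz w) ->
  all (fun s => ~~ contains s w)
    [:: [:: 3; 1; 2]; [:: -3; -1; -2]; [:: 2; -1]; [:: -2; 1]] = good w.
Proof.
move=> uw; apply/idP/andP => [|[/pairwise_subseqP P2 /triplewise_subseqP P3]].
  case/and5P=> /containsP N1 /containsP N2 /containsP N3 /containsP N4 _.
  have P2 x y : subseq [:: x; y] w -> same_sign_inv x y.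
    move=> sxy; have nxy: absz x != absz y.
      have := subseq_uniq (map_subseq absz sxy) uw.
      by rewrite /= inE andbT.
    apply/negPn/negP; rewrite /same_sign_inv => /norP[ge_xy sgn].
    case: (ltP x 0) sgn => sx; case: (ltP y 0) => // sy _.
      apply: N4; exists [:: x; y] => //; split=> // [[|[|a]] [|[|b]]|[|[|a]]] //=; lia.
    apply: N3; exists [:: x; y] => //; split=> // [[|[|a]] [|[|b]]|[|[|a]]] //=; lia.
  split; first exact/pairwise_subseqP.
  apply/triplewise_subseqP=> c a b scab; apply/negP=> /andP[ltab ltbc].
  have /P2 : subseq [:: c; a] w.
    by apply: subseq_trans scab; rewrite /= !eqxx.
  have /P2 : subseq [:: c; b] w.
    apply: subseq_trans scab; rewrite /= eqxx.
    by case: ifP => //=; rewrite eqxx.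
  rewrite /same_sign_inv => scb sca.
  case: (ltP c 0) => sc.
    apply: N2; exists [:: c; a; b] => //.
    split=> // [[|[|[|i]]] [|[|[|j]]]|[|[|[|i]]]] //=; lia.
  apply: N1; exists [:: c; a; b] => //.
  split=> // [[|[|[|i]]] [|[|[|j]]]|[|[|[|i]]]] //=; lia.
have M3 (s : seq int) : size s = 3%N -> `|s`_1| < `|s`_2| -> `|s`_2| < `|s`_0| ->
    ~~ contains s w.
  move=> sz s12 s20; apply/containsP=> -[[|c [|a [|b [|? ?]]]]] svw [];
    rewrite sz //= => _ ord _.
  have := P3 _ _ _ svw; rewrite /not312.
  have /= -> := ord 1%N 2%N isT isT; have /= -> := ord 2%N 0%N isT isT.
  by rewrite s12 s20.
have M2 (s : seq int) : size s = 2%N -> `|s`_1| < `|s`_0| -> (s`_0 < 0) != (s`_1 < 0) ->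
    ~~ contains s w.
  move=> sz s10 sg; apply/containsP=> -[[|x [|y [|? ?]]]] svw [];
    rewrite sz //= => _ ord sgn.
  have := P2 _ _ svw; rewrite /same_sign_inv.
  have /= -> := ord 0%N 1%N isT isT.
  have /= -> := sgn 0%N isT; have /= -> := sgn 1%N isT.
  by rewrite (negPf sg) orbF ltNge ltW.
by rewrite /= (M3 [:: 3; 1; 2]) ?(M3 [:: -3; -1; -2]) ?M2.
Qed.

(** * Trees and words *)

(** The shift by one keeps 0, which has no sign, out of the letters, and makes
    the sign of a letter its constructor. *)
Definition letter (s : bool) (m : nat) : int := if s then Negz m else Posz m.+1.

(** The entries are read in in-order while their absolute values are assigned in
    preorder. *)
Fixpoint word_of (m : nat) (t : tree) : seq int :=
  if t is Node s a b then
    word_of m.+1 a ++ letter s m :: word_of (m.+1 + nodes a) b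
  else [::].

Lemma absz_letter s m : absz (letter s m) = m.+1.
Proof. by case: s. Qed.

Lemma letter_lt0 s m : (letter s m < 0) = s.
Proof. by case: s. Qed.

Lemma perm_word m t : perm_eq (map absz (word_of m t)) (iota m.+1 (nodes t)).
Proof.
elim: t m => //= s a IHa b IHb m.
rewrite map_cat /= absz_letter iotaD -cat1s perm_catCA cat1s perm_cons.
by apply: perm_cat; rewrite ?IHa //= ?addSn IHb.
Qed.

Lemma mem_word m t x :
  x \in word_of m t -> (m < absz x <= m + nodes t)%N.
Proof.
by move/(map_f absz); rewrite (perm_mem (perm_word m t)) mem_iota; lia.
Qed.

Lemma constant_word s m t :
  all (fun x => (x < 0) == s) (word_of m t) = constant s t.
Proof.
by elim: t m => //= s' a IHa b IHb m; rewrite all_cat /= IHa IHb letter_lt0 andbCA.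
Qed.

Lemma split_unique (T : Type) (P : pred T) A A' z z' B B' :
    ~~ has P A -> ~~ has P A' -> P z -> P z' ->
    A ++ z :: B = A' ++ z' :: B' ->
  [/\ A = A', z = z' & B = B'].
Proof.
elim: A A' => [|x A IHA] [|x' A'] //=.
- by move=> _ _ _ _ [-> ->].
- by move=> _ /norP[nPx' _] Pz _ [ezx _]; rewrite -ezx Pz in nPx'.
- by move=> /norP[nPx _] _ _ Pz' [exz _]; rewrite exz Pz' in nPx.
by move=> /norP[_ nA] /norP[_ nA'] Pz Pz' [-> /IHA[]// -> -> ->].
Qed.

(** The entry of smallest absolute value marks the root. *)
Lemma word_of_inj m : injective (word_of m).
Proof.
move=> t; elim: t m => [|s a IHa b IHb] m [|s' a' b'] //=.
- by case: (word_of _ _).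
- by case: (word_of _ _).
have root_only c : ~~ has (fun x => absz x == m.+1) (word_of m.+1 c).
  by apply/hasPn=> x /mem_word; lia.
case/(split_unique (root_only a) (root_only a')); rewrite ?absz_letter //.
by move/IHa=> <- ess' /IHb<-; rewrite -(letter_lt0 s m) ess' letter_lt0.
Qed.

(** In [A z B] with [z] below [A] and [A] below [B], every inversion lies within
    [A], within [B], or between [A] and [z]. *)
Lemma good_cat A z B :
    good A -> good B ->
    (forall x, x \in A -> `|z| < `|x|) -> (forall y, y \in B -> `|z| < `|y|) ->
    (forall x y, x \in A -> y \in B -> `|x| < `|y|) ->
    all (fun x => (x < 0) == (z < 0)) A ->
  good (A ++ z :: B).
Proof.
case/andP=> A2 A3 /andP[B2 B3] zA zB AB /allP sA; apply/andP; split.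
  rewrite pairwise_cat A2 pairwise_cons B2 !andbT; apply/andP; split.
    apply/allrelP=> x y Ax; rewrite inE /same_sign_inv.
    by case/predU1P=> [-> | By]; [rewrite sA ?orbT | rewrite AB].
  by apply/allP=> y By; rewrite /same_sign_inv zB.
elim: A A2 A3 zA AB sA => [_ _ _ _ _ | x A IHA] /=.
  rewrite B3 andbT; apply/pairwise_subseqP=> a b /mem_subseq sab.
  have /zB : b \in B by apply: sab; rewrite !inE eqxx orbT.
  by rewrite /not312; lia.
case/andP=> _ A2 /andP[x2 A3] zA AB sA.
have xA : {subset A <= x :: A} by move=> a Aa; rewrite inE Aa orbT.
have Bx y : y \in B -> `|x| < `|y| by apply: AB; rewrite inE eqxx.
rewrite IHA // ?andbT; last first.
- by move=> a /xA; apply: sA.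
- by move=> a b /xA; apply: AB.
- by move=> a /xA; apply: zA.
rewrite pairwise_cat x2 pairwise_cons /=; apply/and3P; split.
- apply/allrelP=> a y /xA/zA lt_za; rewrite inE /not312.
  by case/predU1P=> [-> | /Bx]; lia.
- by apply/allP=> y /Bx; rewrite /not312; lia.
apply/pairwise_subseqP=> a b /mem_subseq sab.
have /Bx : b \in B by apply: sab; rewrite !inE eqxx orbT.
by rewrite /not312; lia.
Qed.

Lemma good_word m t : coherent t -> good (word_of m t).
Proof.
elim: t m => //= s a IHa b IHb m /andP[csa cb].
apply: good_cat; rewrite ?IHb ?IHa ?(constant_coherent csa) //.
- by move=> x /mem_word; have := absz_letter s m; lia.
- by move=> x /mem_word; have := absz_letter s m; lia.
- by move=> x y /mem_word Ax /mem_word; lia.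
by rewrite letter_lt0 constant_word.
Qed.

(** Sorting both parts separately already sorts their concatenation, which must
    then be the interval itself. *)
Lemma perm_iota_cat m n (X Y : seq nat) :
    perm_eq (X ++ Y) (iota m n) ->
    (forall x y, x \in X -> y \in Y -> (x < y)%N) ->
  perm_eq X (iota m (size X)) /\ perm_eq Y (iota (m + size X) (size Y)).
Proof.
move=> pXY ltXY; have szn : n = (size X + size Y)%N.
  by rewrite -size_cat (perm_size pXY) size_iota.
have eqXY : sort leq X ++ sort leq Y = iota m (size X) ++ iota (m + size X) (size Y).
  rewrite -iotaD -szn; apply: (sorted_eq leq_trans anti_leq).
  - have tot := leq_total; rewrite (sorted_pairwise leq_trans) pairwise_cat.
    rewrite -!(sorted_pairwise leq_trans) !sort_sorted // !andbT.
    by apply/allrelP=> x y; rewrite !mem_sort => Xx Yy; apply/ltnW/ltXY.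
  - exact: iota_sorted.
  apply: perm_trans pXY.
  by apply: perm_cat; rewrite perm_sort.
move/eqP: eqXY; rewrite eqseq_cat ?size_sort ?size_iota //.
by case/andP=> /eqP<- /eqP<-; rewrite ![perm_eq _ (sort _ _)]perm_sym !perm_sort.
Qed.

Lemma good_subseq v w : subseq v w -> good w -> good v.
Proof.
move=> svw /andP[/pairwise_subseqP w2 /triplewise_subseqP w3]; apply/andP; split.
  by apply/pairwise_subseqP=> x y sxy; apply/w2/(subseq_trans sxy).
by apply/triplewise_subseqP=> x y z sxyz; apply/w3/(subseq_trans sxyz).
Qed.

Lemma word_of_surj m n w :
    perm_eq (map absz w) (iota m.+1 n) -> good w ->
  exists t, [/\ coherent t, nodes t = n & word_of m t = w].
Proof.
elim/ltn_ind: n m w => -[|n] IHn m w pw gw.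
  exists Leaf; split=> //; move/perm_size: pw.
  by rewrite size_map => /eqP; rewrite size_eq0 => /eqP->.
have /mapP[z wz ez] : m.+1 \in map absz w.
  by rewrite (perm_mem pw) mem_iota; lia.
have [s ezs] : exists s, z = letter s m.
  by case: z ez {wz} => k /= => [<-|[->]]; [exists false | exists true].
rewrite {}ezs {z ez} in wz.
case/splitPr: wz pw gw => A B pw gw.
have [gA gB] : good A /\ good B.
  split; apply: good_subseq gw; first exact: prefix_subseq.
  exact: (subseq_trans (subseq_cons _ _) (suffix_subseq _ _)).
have {}pw : perm_eq (map absz A ++ map absz B) (iota m.+2 n).
  move: pw; rewrite map_cat /= absz_letter -cat1s perm_catCA cat1s.
  by rewrite perm_cons.
have gtm x : x \in A ++ B -> (m.+1 < absz x)%N.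
  by move/(map_f absz); rewrite map_cat (perm_mem pw) mem_iota => /andP[].
(* An entry of [A] above an entry of [B] would form a 312 around the minimum. *)
have A_lt_B x y : x \in A -> y \in B -> (absz x < absz y)%N.
  move=> Ax By; rewrite ltn_neqAle; apply/andP; split.
    have := perm_uniq pw; rewrite iota_uniq cat_uniq => /and3P[_ /hasPn disj _].
    by apply: contraNneq (disj _ (map_f absz By)) => <-; apply: map_f.
  have /(triplewise_subseqP _ _ (proj2 (andP gw))) :
      subseq [:: x; letter s m; y] (A ++ letter s m :: B).
    by rewrite -cat1s cat_subseq ?sub1seq //= eqxx sub1seq.
  have := absz_letter s m; have : (m.+1 < absz y)%N.
    by apply: gtm; rewrite mem_cat By orbT.
  by rewrite /not312; lia.
(* Every entry of [A] forms an inversion with the minimum. *)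
have sA : all (fun x => (x < 0) == s) A.
  apply/allP=> x Ax.
  have /(pairwise_subseqP _ _ (proj1 (andP gw))) :
      subseq [:: x; letter s m] (A ++ letter s m :: B).
    by rewrite -cat1s cat_subseq ?sub1seq ?mem_head.
  have := absz_letter s m; have : (m.+1 < absz x)%N.
    by apply: gtm; rewrite mem_cat Ax.
  by rewrite /same_sign_inv letter_lt0; lia.
have szn : (size A + size B)%N = n.
  by have := perm_size pw; rewrite size_cat !size_map size_iota.
have [|pA pB] := perm_iota_cat pw.
  by move=> _ _ /mapP[x Ax ->] /mapP[y By ->]; apply: A_lt_B.
rewrite !size_map in pA pB.
have [|a [ca na eA]] := IHn (size A) _ m.+1 A pA gA; first by lia.
have [|b [cb nb eB]] := IHn (size B) _ (m.+1 + size A)%N B pB gB; first by lia.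
exists (Node s a b); rewrite /= na nb eA eB szn cb andbT.
by rewrite -(constant_word s m.+1) eA.
Qed.

Lemma is_signed_permE n w : is_signed_perm n w = perm_eq (map absz w) (iota 1 n).
Proof. by []. Qed.

Lemma word_bij n :
  exists f : {t | tree_pred n t} ->
             signed_perm_avoiding n
               [:: [:: 3; 1; 2]; [:: -3; -1; -2]; [:: 2; -1]; [:: -2; 1]],
    bijective f.
Proof.
apply: (@sig_bijection _ _ _ _ (word_of 0)) => [t|t t' _ _|w].
- case/andP=> ct /eqP<-; have pt := perm_word 0 t; rewrite is_signed_permE pt.
  by rewrite avoids_good ?good_word // (perm_uniq pt) iota_uniq.
- exact: word_of_inj.
rewrite is_signed_permE => /andP[pw]; rewrite avoids_good; last first.
  by rewrite (perm_uniq pw) iota_uniq.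
case/(word_of_surj pw) => t [ct nt <-].
by exists t; rewrite // /tree_pred ct nt eqxx.
Qed.

Theorem corollary2p2 (n : nat) (hn : (1 <= n)%N) :
  exists f : grand_dyck n ->
             signed_perm_avoiding n
               [:: [:: 3; 1; 2]; [:: -3; -1; -2]; [:: 2; -1]; [:: -2; 1]],
    bijective f.
Proof.
have [f [g fK gK]] := path_bij n; have [h bij_h] := word_bij n.
by exists (h \o g); apply: bij_comp bij_h _; exists f.
Qed.
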